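(* For every $\varepsilon>0$ there exist arbitrarily large simple graphs $G$ with no isolated vertices, with no $\Delta(G)$-weak edges, and such that $\Delta(G)\ge(2-\varepsilon)\,\mathrm{ad}(G)$.
   Context: $\Delta(G)$ is the maximum degree and $\mathrm{ad}(G)=\frac{1}{|V(G)|}\sum_{v}d(v)$ the average degree of $G$. For an integer $D$ and a vertex $u$, $d^D(u)$ denotes the number of neighbors of $u$ of degree exactly $D$. For a statement $P$, $[P]$ is $1$ if $P$ holds and $0$ otherwise. An edge $uv$ is $(D,u)$-weak if $d^D(u)\le D-d(v)+[d(v)=D]$, and $uv$ is $D$-weak if it is $(D,u)$-weak or $(D,v)$-weak. *)

(* Defs.v *)
From mathcomp Require Import all_boot all_order all_algebra.
From mathcomp Require Import reals.

Set Implicit Arguments.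
Unset Strict Implicit.
Unset Printing Implicit Defensive.

Import Order.TTheory GRing.Theory Num.Theory.

Local Open Scope ring_scope.

Record sgraph := SGraph {
  vertex :> finType;
  adj : rel vertex;
  adj_sym : symmetric adj;
  adj_irrefl : irreflexive adj }.

Definition deg (G : sgraph) (v : G) : nat := #|[set w | adj v w]|.

Definition max_deg (G : sgraph) : nat := \max_(v : G) deg v.

Definition avg_deg (R : numFieldType) (G : sgraph) : R :=
  (\sum_(v : G) (deg v)%:R) / #|G|%:R.

Definition isolated (G : sgraph) (v : G) : bool := deg v == 0%N.

Definition num_nbr_deg (G : sgraph) (D : int) (u : G) : nat :=
  #|[set w | adj u w && ((deg w)%:Z == D)]|.

(* The subtraction is in int: D is not assumed to be at least deg v. *)
Definition weak_at (G : sgraph) (D : int) (u v : G) : bool :=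
  (num_nbr_deg D u)%:Z <= D - (deg v)%:Z + ((deg v)%:Z == D)%:Z.

(* (D, v)-weakness of the unordered edge uv is weak_at with the roles of its
   endpoints exchanged. *)
Definition weak_edge (G : sgraph) (D : int) (u v : G) : bool :=
  [&& adj u v & weak_at D u v || weak_at D v u].

(* Main.v *)
(* Fix m > 0 and p = m + 1.  Take p disjoint copies of K_{p,m} and join all
   p ^ 2 vertices of the sides of size p into a clique.  A clique vertex then has
   p ^ 2 - 1 clique neighbours and m others, hence degree D = m ^ 2 + 3 m, while
   the p m remaining vertices have degree p and only clique neighbours.  A clique
   vertex has D - m = D - p + 1 neighbours of degree D, just enough for none of
   its edges to be weak.  Almost half of the vertices have degree p = o(D), so
   the average degree is asymptotically D / 2. *)
Require Import Defs.
From mathcomp Require Import all_boot all_order all_algebra.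
From mathcomp Require Import reals.
From mathcomp Require Import zify lra.

Set Implicit Arguments.
Unset Strict Implicit.
Unset Printing Implicit Defensive.

Import Order.TTheory GRing.Theory Num.Theory.

Local Open Scope ring_scope.

Lemma card_sum_set (A B : finType) (P : pred (A + B)) :
  #|[set w | P w]| = (#|[set a | P (inl a)]| + #|[set b | P (inr b)]|)%N.
Proof. by rewrite -!sum1dep_card big_sumType. Qed.

Lemma card_fst_eq (A B : finType) (x : A) :
  #|[set w : A * B | x == w.1]| = #|B|.
Proof.
rewrite -[RHS]mul1n -(cards1 x) -cardsT -cardsX; apply: eq_card => -[a b].
by rewrite !inE andbT eq_sym.
Qed.

Section CliqueBlowup.

Variable m : nat.
Local Notation p := m.+1.

(** The first coordinate is the index of the copy of K_{p,m}; [inl] marks the side of size [p],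
    which goes into the clique, and [inr] the side of size [m]. *)
Definition blowup_vertex : finType := ('I_p * 'I_p + 'I_p * 'I_m)%type.

Definition blowup_adj : rel blowup_vertex := fun u v =>
  match u, v with
  | inl a, inl b => a != b
  | inl a, inr b => a.1 == b.1
  | inr a, inl b => a.1 == b.1
  | inr _, inr _ => false
  end.

Lemma blowup_adj_sym : symmetric blowup_adj.
Proof. by move=> [a|a] [b|b] //=; rewrite eq_sym. Qed.

Lemma blowup_adj_irrefl : irreflexive blowup_adj.
Proof. by move=> [a|a] //=; rewrite eqxx. Qed.

Definition blowup : sgraph := SGraph blowup_adj_sym blowup_adj_irrefl.

Lemma card_blowup : #|blowup| = (p * (2 * m + 1))%N.
Proof. by rewrite card_sum !card_prod !card_ord; lia. Qed.

Lemma card_clique_nbr (a : 'I_p * 'I_p) :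
  #|[set b | a != b]| = (m ^ 2 + 2 * m)%N.
Proof.
have -> : [set b | a != b] = ~: [set a].
  by apply/setP=> b; rewrite !inE eq_sym.
by have := cardsC [set a]; rewrite cards1 card_prod card_ord; lia.
Qed.

Lemma deg_blowup_l a : deg (inl a : blowup) = (m ^ 2 + 3 * m)%N.
Proof.
by rewrite /deg card_sum_set /= card_clique_nbr card_fst_eq card_ord; lia.
Qed.

Lemma deg_blowup_r b : deg (inr b : blowup) = p.
Proof.
rewrite /deg card_sum_set /= card_fst_eq card_ord.
by rewrite (_ : [set _ | false] = set0) ?cards0 ?addn0 //.
Qed.

Lemma max_deg_blowup : (0 < m)%N -> max_deg blowup = (m ^ 2 + 3 * m)%N.
Proof.
move=> m_gt0; apply/eqP; rewrite eqn_leq; apply/andP; split.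
  by apply/bigmax_leqP => -[a|b] _; rewrite ?deg_blowup_l ?deg_blowup_r //; nia.
rewrite -(deg_blowup_l (ord0, ord0)).
exact: (@leq_bigmax _ (fun v : blowup => deg v)).
Qed.

(** Since [p] is not the maximum degree, exactly the clique vertices attain it, so only clique
    neighbours are counted. *)
Lemma num_nbr_deg_blowup (u : blowup) : (0 < m)%N ->
  num_nbr_deg (max_deg blowup)%:Z u
  = if u is inl _ then (m ^ 2 + 2 * m)%N else p.
Proof.
move=> m_gt0; rewrite max_deg_blowup // /num_nbr_deg card_sum_set.
under eq_finset => a do rewrite deg_blowup_l eqxx andbT.
under [X in (_ + #|pred_of_set X|)%N]eq_finset => b.
  rewrite deg_blowup_r (_ : (_ == _) = false) ?andbF; last by apply/eqP; nia.
  over.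
rewrite (_ : [set _ | false] = set0) ?cards0 ?addn0; last first.
  by apply/setP=> x; rewrite !inE.
by case: u => [a|b] /=; rewrite ?card_clique_nbr // card_fst_eq card_ord.
Qed.

Lemma weak_at_blowup (u v : blowup) :
  (0 < m)%N -> adj u v -> ~~ weak_at (max_deg blowup)%:Z u v.
Proof.
move=> m_gt0; rewrite /weak_at num_nbr_deg_blowup // max_deg_blowup // -ltNge.
(* For [v] in the clique the bound is 1, below both possible counts as [m > 0]. For [v] outside it
   is [m ^ 2 + 2 * m - 1], one less than the count at [u]. *)
case: u v => [a|a] [b|b] // _; rewrite ?deg_blowup_l ?deg_blowup_r ?eqxx.
- by nia.
- by rewrite (_ : (_ == _) = false); [nia | apply/eqP; nia].
- by nia.
Qed.

Lemma weak_edge_blowup (u v : blowup) :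
  (0 < m)%N -> ~~ weak_edge (max_deg blowup)%:Z u v.
Proof.
move=> m_gt0; rewrite /weak_edge; apply/negP => /andP[uv].
by apply/negP; rewrite negb_or !weak_at_blowup // adj_sym.
Qed.

Lemma sum_deg_blowup :
  (\sum_(v : blowup) deg v = p ^ 2 * (m ^ 2 + 4 * m))%N.
Proof.
rewrite big_sumType /=.
under eq_bigr do rewrite deg_blowup_l.
under [X in (_ + X)%N]eq_bigr do rewrite deg_blowup_r.
by rewrite !sum_nat_const !card_prod !card_ord; nia.
Qed.

Lemma avg_deg_blowup (R : numFieldType) :
  avg_deg R blowup = (p * (m ^ 2 + 4 * m))%:R / (2 * m + 1)%:R.
Proof.
rewrite /avg_deg -natr_sum sum_deg_blowup card_blowup expnS expn1 -mulnA.
by rewrite !(natrM _ p) -mulf_div divff ?mul1r // pnatr_eq0.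
Qed.

End CliqueBlowup.

Theorem theorem4 (R : realType) (eps : R) (heps : 0 < eps) (n : nat) :
  exists G : sgraph,
    [/\ (n <= #|G|)%N,
        forall v : G, ~~ isolated v,
        forall u v : G, ~~ weak_edge (max_deg G)%:Z u v
      & (2 - eps) * avg_deg R G <= (max_deg G)%:R].
Proof.
(* The term [n] makes the graph large enough; the other one gives [eps * m >= 3], which drives the
   final inequality. *)
pose m := (maxn n (Num.bound (3 / eps))).+1.
have m_gt0 : (0 < m)%N by [].
have eps_m : 3 <= eps * m%:R.
  rewrite mulrC -ler_pdivrMr //; apply/ltW.
  have /archi_boundP/lt_le_trans : 0 <= 3 / eps by rewrite divr_ge0 // ltW.
  by apply; rewrite ler_nat; lia.
have n_le_m : (n <= m)%N by lia.
clearbody m; exists (blowup m); split.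
- by rewrite card_blowup; nia.
- by case=> [a|b]; rewrite /isolated ?deg_blowup_l ?deg_blowup_r //; lia.
- by move=> u v; apply: weak_edge_blowup.
rewrite avg_deg_blowup max_deg_blowup // mulrA ler_pdivrMr ?ltr0n ?addn1 //.
rewrite -[m.+1]addn1 -[(2 * m).+1]addn1 !(natrM, natrD, natrX).
have : 0 < m%:R :> R by rewrite ltr0n.
move: (m%:R) eps_m => x eps_x x_gt0.
(* After division by x the claim reads 3 x + 5 <= eps (x + 1) (x + 4). *)
have : 0 <= (eps * x - 3) * (x * (x + 4)) by apply: mulr_ge0; nra.
have : 0 <= eps * (x * (x + 4)) by apply: mulr_ge0; nra.
(* The two facts add up to [3 * x * (x + 4) <= eps * x * (x + 1) * (x + 4)], and
   [3 * x + 5 <= 3 * (x + 4)]. *)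
by nra.
Qed.
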